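(* Let $\mathcal{B}^*$ be the three-receiver unicast index coding problem described in the context, with equivalent single unicast side information graph $G^*$ on $[12]$ and underlying undirected graph $G^*_u$. For any $S \subseteq [12]$, the optimal broadcast rate among index codes with locality $1$ for the sub-problem $\mathcal{B}^*_S$ satisfies $$\beta^*_{\mathcal{B}^*_S}(1) = \bar{\chi}(G^*_{S,u}),$$ where $\bar{\chi}$ denotes the clique cover number and $G^*_{S,u}$ is the subgraph of $G^*_u$ induced by $S$.
   Context: Index coding model. A unicast index coding problem has $n$ receivers $u_1,\dots,u_n$ and $N$ messages $\mathbf{x}_1,\dots,\mathbf{x}_N$, each a vector in $\mathcal{A}^m$ for a finite alphabet $\mathcal{A}$ and a positive integer $m$ (the message length; all messages have the same length). Receiver $u_i$ demands $\mathbf{x}_j$, $j\in W_i$, and knows $\mathbf{x}_j$, $j\in K_i$, as side information, where $W_i,K_i\subseteq[N]$, $W_i\cap K_i=\emptyset$, the $W_i$ are pairwise disjoint and every message is demanded by exactly one receiver. An index code consists of an encoder mapping $(\mathbf{x}_1,\dots,\mathbf{x}_N)$ to a codeword $\mathbf{c}\in\mathcal{A}^\ell$, subsets $R_i\subseteq[\ell]$ (receiver $u_i$ observes only $\mathbf{c}_{R_i}=(c_k)_{k\in R_i}$), and decoders at each $u_i$ mapping $(\mathbf{c}_{R_i},\mathbf{x}_{K_i})$ to $\mathbf{x}_{W_i}$. It is valid if every receiver decodes its demand correctly for all message values. Its broadcast rate is $\beta=\ell/m$. The locality at $u_i$ is $r_i=|R_i|/(m|W_i|)$ and the locality of the code is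 $r=\max_i r_i$ (receivers with no demand impose no constraint). For a problem $\mathcal{B}$, $\beta^*_{\mathcal{B}}(r)$ is the infimum of broadcast rates of all valid index codes, over all message lengths $m\ge1$, with locality at most $r$. The problem $\mathcal{B}^*$: three receivers $u_1,u_2,u_3$ and 12 messages $\mathbf{x}_1,\dots,\mathbf{x}_{12}$ with $W_1=\{1,2,3,4\}$, $W_2=\{5,6,7,8\}$, $W_3=\{9,10,11,12\}$, $K_1=\{5,6,9,10\}$, $K_2=\{1,2,9,11\}$, $K_3=\{1,3,5,7\}$. For $S\subseteq[12]$, $\mathcal{B}^*_S$ is the sub-problem with receivers $u_1,u_2,u_3$, messages $\mathbf{x}_j$, $j\in S$, demand sets $W_i\cap S$ and side information sets $K_i\cap S$. Graphs. $G^*$ is the directed graph on vertex set $[12]$ with a directed edge $(a,b)$ if and only if $b\in K_i$, where $i$ is the unique receiver with $a\in W_i$. $G^*_u$ is the undirected graph on $[12]$ in which $\{a,b\}$ is an edge if and only if both $(a,b)$ and $(b,a)$ are edges of $G^*$. For $S\subseteq[12]$, $G^*_S$ and $G^*_{S,u}$ denote the subgraphs of $G^*$ and $G^*_u$ induced by $S$. *)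

(* Defs.v *)
From HB Require Import structures.
From mathcomp Require Import all_boot all_order all_algebra.
Set Implicit Arguments. Unset Strict Implicit. Unset Printing Implicit Defensive.
Import Order.TTheory GRing.Theory Num.Theory.

(* Messages x_1..x_12 are indexed by 'I_12 (x_{j+1} <-> j); receivers u_1..u_3 by 'I_3. *)
Definition idx_set (s : seq nat) : {set 'I_12} := [set j : 'I_12 | val j \in s].

Definition W (i : 'I_3) : {set 'I_12} :=
  match val i with
  | 0 => idx_set [:: 0; 1; 2; 3]
  | 1 => idx_set [:: 4; 5; 6; 7]
  | _ => idx_set [:: 8; 9; 10; 11]
  end.

Definition K (i : 'I_3) : {set 'I_12} :=
  match val i with
  | 0 => idx_set [:: 4; 5; 8; 9]
  | 1 => idx_set [:: 0; 1; 8; 10]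
  | _ => idx_set [:: 0; 2; 4; 6]
  end.

Definition Gstar (a b : 'I_12) : bool := [exists i : 'I_3, (a \in W i) && (b \in K i)].

Definition Gstar_u (a b : 'I_12) : bool := Gstar a b && Gstar b a.

Definition clique_partition (S : {set 'I_12}) (P : {set {set 'I_12}}) : bool :=
  partition P S &&
  [forall C in P, forall a in C, forall b in C, (a != b) ==> Gstar_u a b].

(* clique cover number of G^*_{S,u}: minimum number of cliques partitioning S
   (the default 12 is never reached: singletons always form such a partition) *)
Definition clique_cover_number (S : {set 'I_12}) : nat :=
  \big[minn/12]_(P : {set {set 'I_12}} | clique_partition S P) #|P|.

Definition msgs (A : Type) (S : {set 'I_12}) (m : nat) :=
  {j : 'I_12 | j \in S} -> 'I_m -> A.

Definition achievable_rate_loc1 (A : finType) (S : {set 'I_12}) (q : rat) : Prop :=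
  exists (m l : nat)
         (enc : msgs A S m -> 'I_l -> A)
         (R : 'I_3 -> {set 'I_l})
         (dec : forall i : 'I_3,
                  ({k : 'I_l | k \in R i} -> A) ->
                  (forall j : {j : 'I_12 | j \in S}, val j \in K i -> 'I_m -> A) ->
                  forall j : {j : 'I_12 | j \in S}, val j \in W i -> 'I_m -> A),
    [/\ (0 < m)%N,
        (forall (x : msgs A S m) (i : 'I_3) (j : {j : 'I_12 | j \in S})
                (hj : val j \in W i) (t : 'I_m),
            dec i (fun k => enc x (val k)) (fun j' _ => x j') j hj t = x j t),
        (forall i : 'I_3, W i :&: S != set0 -> (#|R i| <= m * #|W i :&: S|)%N) &
        q = (l%:R / m%:R)%R].

Definition is_infimum (P : rat -> Prop) (v : rat) : Prop :=
  (forall q, P q -> (v <= q)%R) /\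
  (forall e : rat, (0 < e)%R -> exists q, P q /\ (q < v + e)%R).

(* Main.v *)
Require Import Defs.
From mathcomp Require Import all_boot all_order all_algebra.
From Stdlib Require Import FunctionalExtensionality.

(* With locality 1 a receiver [i] sees as many symbols as it demands, so for each
   value of its side information its symbols are in bijection with its demand, and
   hence are functions of [W i :|: K i] alone.  A symbol seen by [i] and [j] is then a
   function of what both know, so the symbols [i] shares with a set [O] of other
   receivers number at most [m * #|W i :&: \bigcup_(j in O) K j|].  For a tournament on
   the receivers, discarding from [R i] the symbols shared with the out-neighbours of
   [i] leaves pairwise disjoint sets, so the code length is at least [m] times the
   number of messages that no out-neighbour of their receiver knows.  These messages
   are independent in [G^*_u]; for every [S], a best choice of tournament matches the
   size of some clique partition of [S].  Conversely a clique partition gives a code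
   with message length 1 that sends, for each clique, the sum of its messages. *)

Set Implicit Arguments.
Unset Strict Implicit.
Unset Printing Implicit Defensive.

Import Order.TTheory GRing.Theory Num.Theory.

Lemma sum_card_incidence (I J : finType) (F : I -> {set J}) :
  \sum_i #|F i| = \sum_a #|[set i | a \in F i]|.
Proof.
under eq_bigr => i _ do rewrite -sum1_card big_mkcond /=.
rewrite exchange_big; apply: eq_bigr => a _ /=.
by rewrite -sum1_card [RHS]big_mkcond; apply: eq_bigr => i _; rewrite inE.
Qed.

(** * Converse for an arbitrary unicast problem with locality 1 *)

Section LocalityOneConverse.

Variables (J C I A : finType) (m : nat) (a0 : A).
Hypothesis A_gt1 : 1 < #|A|.

Let M : finType := {ffun 'I_m -> A}.

Variables (Wt Kn : I -> {set J}) (R : I -> {set C}).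
Variable E : {ffun J -> M} -> C -> A.

Hypothesis disjWK : forall i, [disjoint Wt i & Kn i].
Hypothesis disjWW : forall i j, i != j -> [disjoint Wt i & Wt j].
Hypothesis coverW : forall a, exists i, a \in Wt i.
Hypothesis decodable : forall i (x y : {ffun J -> M}),
  {in R i, E x =1 E y} -> {in Kn i, x =1 y} -> {in Wt i, x =1 y}.
Hypothesis local1 : forall i, #|R i| <= m * #|Wt i|.

Definition patch (x : {ffun J -> M}) (B : {set J})
    (w : {ffun {j | j \in B} -> M}) : {ffun J -> M} :=
  [ffun j => if insub j is Some u then w u else x j].

Lemma patch_in x (B : {set J}) (w : {ffun {j | j \in B} -> M}) u :
  patch x w (val u) = w u.
Proof. by rewrite ffunE valK. Qed.

Lemma patch_out x (B : {set J}) (w : {ffun {j | j \in B} -> M}) j :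
  j \notin B -> patch x w j = x j.
Proof. by move=> jB; rewrite ffunE insubN. Qed.

Lemma card_values (B : {set J}) : #|{ffun {j | j \in B} -> M}| = #|A| ^ (m * #|B|).
Proof. by rewrite card_ffun card_ffun card_ord card_sig -expnM. Qed.

Lemma card_symbols (Q : {set C}) : #|{ffun {k | k \in Q} -> A}| = #|A| ^ #|Q|.
Proof. by rewrite card_ffun card_sig. Qed.

Lemma WK_notin i j : j \in Kn i -> j \notin Wt i.
Proof. by move=> jK; apply/negP => /(disjointFr (disjWK i)); rewrite jK. Qed.

Definition symbols i (x : {ffun J -> M}) (w : {ffun {j | j \in Wt i} -> M}) :=
  [ffun k : {k | k \in R i} => E (patch x w) (val k)].

(** Changing only the demand leaves the side information alone, so equal observed symbols must
    decode to equal demands. *)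
Lemma symbols_inj i x : injective (@symbols i x).
Proof.
move=> w w' /ffunP eqR; apply/ffunP => u.
rewrite -!(patch_in x); apply: (@decodable i) (valP u) => [k kR|j /WK_notin jW].
  by have := eqR (exist _ k kR); rewrite !ffunE.
by rewrite !patch_out.
Qed.

Lemma leq_card_R i : m * #|Wt i| <= #|R i|.
Proof.
have x0 : {ffun J -> M} := [ffun=> [ffun=> a0]].
by have := leq_card _ (@symbols_inj i x0); rewrite card_values card_symbols leq_exp2l.
Qed.

(* Locality 1 makes the injective map [symbols x] bijective. *)
Lemma symbols_onto i (x : {ffun J -> M}) (c : C -> A) :
  exists y : {ffun J -> M},
    {in R i, E y =1 c} /\ forall j, j \notin Wt i -> y j = x j.
Proof.
have le : #|{ffun {k | k \in R i} -> A}| <= #|{ffun {j | j \in Wt i} -> M}|.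
  by rewrite card_values card_symbols leq_exp2l.
have /codomP[w /ffunP eqw] :=
  inj_card_onto (@symbols_inj i x) le [ffun k => c (val k)].
exists (patch x w); split=> [k kR|j jW]; last exact: patch_out.
by have := eqw (exist _ k kR); rewrite !ffunE.
Qed.

(** Alter [x] on the demand to some [z] producing the symbols of [y]. Receiver [i] cannot tell [z]
    from [y], so decoding forces [z] to agree with [y], hence with [x], on the demand; thus
    [z = x]. *)
Lemma symbols_determined i (x y : {ffun J -> M}) :
  {in Wt i :|: Kn i, x =1 y} -> {in R i, E x =1 E y}.
Proof.
move=> eqxy; have [z [zR zx]] := symbols_onto i x (E y).
suff <- : z = x by [].
apply/ffunP => j; have [jW|/zx //] := boolP (j \in Wt i).
rewrite (@decodable i z y zR _ j jW) => [|j' jK].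
  by rewrite eqxy // inE jW.
by rewrite zx ?WK_notin // eqxy // inE jK orbT.
Qed.

(* Mixing [x] and [y] shows that a symbol seen by both receivers only
   depends on what both of them know after decoding. *)
Lemma common_symbol i j k (x y : {ffun J -> M}) :
  k \in R i -> k \in R j ->
  {in (Wt i :|: Kn i) :&: (Wt j :|: Kn j), x =1 y} -> E x k = E y k.
Proof.
move=> ki kj eqxy.
pose z : {ffun J -> M} := [ffun a => if a \in Wt i :|: Kn i then x a else y a].
rewrite (@symbols_determined i x z) => [|a ai|//]; last by rewrite ffunE ai.
apply: (@symbols_determined j) kj => a aj; rewrite ffunE.
by case: ifP => // ai; rewrite eqxy // in_setI ai.
Qed.

(** Every word on [Q] occurs with the side information held fixed, and it then depends only on the
    messages in [B]; so there are at most as many words as values on [B]. *)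
Lemma leq_card_determined i (Q : {set C}) (B : {set J}) :
  Q \subset R i -> B \subset Wt i ->
  (forall x y : {ffun J -> M}, {in B :|: Kn i, x =1 y} -> {in Q, E x =1 E y}) ->
  #|Q| <= m * #|B|.
Proof.
move=> QR BW detQ.
pose x0 : {ffun J -> M} := [ffun=> [ffun=> a0]].
pose psi (w : {ffun {j | j \in B} -> M}) :=
  [ffun k : {k | k \in Q} => E (patch x0 w) (val k)].
rewrite -(leq_exp2l _ _ A_gt1) -card_values -card_symbols.
apply: leq_trans (leq_image_card psi _); apply: subset_leq_card.
apply/subsetP => c _.
(* The word [c] is prescribed on [Q]; the value [a0] elsewhere is arbitrary. *)
pose c' k := if insub k is Some u then c u else a0.
have [y [yR yx0]] := symbols_onto i x0 c'.
apply/imageP; exists [ffun u => y (val u)] => //.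
apply/ffunP => k; rewrite ffunE.
have kQ := valP k; have /yR := subsetP QR _ kQ.
rewrite /c' valK => <-; apply: detQ kQ => a.
rewrite inE; have [aB _|aB /= /WK_notin aW] := boolP (a \in B).
  by rewrite (patch_in x0 _ (exist _ a aB)) ffunE.
by rewrite patch_out // yx0.
Qed.

(** Demands are disjoint, so what [i] and [j] both know lies in [Kn i] or in [Wt i :&: Kn j]. *)
Lemma leq_card_shared i (O : {set I}) : i \notin O ->
  #|R i :&: \bigcup_(j in O) R j| <= m * #|Wt i :&: \bigcup_(j in O) Kn j|.
Proof.
move=> iO; apply: (@leq_card_determined i); rewrite ?subsetIl // => x y eqxy k.
rewrite inE => /andP[ki /bigcupP[j jO kj]].
apply: common_symbol ki kj _ => a; rewrite inE => /andP[ai aj].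
apply: eqxy; rewrite !inE in ai aj *.
case/orP: ai => [ai|->]; last by rewrite orbT.
rewrite ai /=; apply/orP; left; apply/bigcupP; exists j => //.
have ij : i != j by apply: contraNneq iO => ->.
by rewrite (disjointFr (disjWW ij) ai) in aj.
Qed.

(* The sets [R i :\: \bigcup_(j | out i j) R j] are pairwise disjoint because
   [out] relates any two receivers in at least one direction. *)
Lemma tournament_bound (out : rel I) (B : {set J}) :
  irreflexive out -> (forall i j, i != j -> out i j || out j i) ->
  (forall a i j, a \in B -> a \in Wt i -> out i j -> a \notin Kn j) ->
  m * #|B| <= #|C|.
Proof.
move=> irr tot indep.
pose O i := [set j | out i j].
pose Q i := R i :\: \bigcup_(j in O i) R j.
have leQ i : m * #|B :&: Wt i| <= #|Q i|.
  have iO : i \notin O i by rewrite inE irr.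
  have sub : B :&: Wt i \subset Wt i :\: \bigcup_(j in O i) Kn j.
    apply/subsetP => a; rewrite !inE => /andP[aB aW]; rewrite aW andbT.
    apply/bigcupP => -[j]; rewrite inE => /(indep a i j aB aW) /negP.
    by [].
  apply: leq_trans (leq_mul (leqnn m) (subset_leq_card sub)) _.
  (* Split both demand and observed symbols into shared and unshared parts, then cancel the bound on
     the shared ones. *)
  have := leq_card_shared iO; have := leq_card_R i.
  rewrite -(cardsID (\bigcup_(j in O i) Kn j) (Wt i)).
  rewrite -(cardsID (\bigcup_(j in O i) R j) (R i)) mulnDr => le1 le2.
  by rewrite -(leq_add2l (m * #|Wt i :&: \bigcup_(j in O i) Kn j|))
    (leq_trans le1) // leq_add2r.
have -> : #|C| = \sum_(k : C) 1 by rewrite sum1_card.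
apply: (@leq_trans (\sum_i #|Q i|)).
  apply: (@leq_trans (\sum_i m * #|B :&: Wt i|)); last exact: leq_sum.
  (* Double counting: each message of [B] is demanded at least once here, and below each symbol lies
     in at most one [Q i]. *)
  rewrite -big_distrr leq_mul2l sum_card_incidence -sum1_card big_mkcond /=.
  apply/orP; right; apply: leq_sum => a _; case: ifP => // aB.
  have [i aW] := coverW a.
  by rewrite card_gt0; apply/set0Pn; exists i; rewrite !inE aB.
rewrite sum_card_incidence; apply: leq_sum => k _.
apply/card_le1_eqP => i j; rewrite !inE => /andP[iO ki] /andP[jO kj].
apply: contraNeq iO => /tot/orP[ji|ij]; last first.
  by apply/bigcupP; exists j; rewrite ?inE.
by case/negP: jO; apply/bigcupP; exists i; rewrite ?inE.
Qed.

End LocalityOneConverse.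

(** * Finite verification of clique families against tournaments *)

(** Plain naturals let the checks run by [vm_compute]; the receiver demanding message [a] is
    [a %/ 4]. *)
Definition known (i : nat) : seq nat :=
  nth [::] [:: [:: 4; 5; 8; 9]; [:: 0; 1; 8; 10]; [:: 0; 2; 4; 6]] i.

Lemma in_W i (a : 'I_12) : (a \in W i) = (val a %/ 4 == val i).
Proof.
by case: i => [[|[|[|//]]] ?]; rewrite inE;
  case: a => [[|[|[|[|[|[|[|[|[|[|[|[|//]]]]]]]]]]]] ?].
Qed.

Lemma in_K i (b : 'I_12) : (b \in K i) = (val b \in known (val i)).
Proof. by case: i => [[|[|[|//]]] ?]; rewrite in_set. Qed.

Definition adj (a b : nat) := (b \in known (a %/ 4)) && (a \in known (b %/ 4)).

Lemma GstarE (a b : 'I_12) : Gstar a b = (val b \in known (val a %/ 4)).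
Proof.
have lt3 : val a %/ 4 < 3 by rewrite ltn_divLR ?ltn_ord.
apply/existsP/idP => [[i]|bK].
  by rewrite in_W in_K => /andP[/eqP->].
by exists (Ordinal lt3); rewrite in_W in_K eqxx.
Qed.

Lemma Gstar_uE (a b : 'I_12) : Gstar_u a b = adj (val a) (val b).
Proof. by rewrite /Gstar_u !GstarE. Qed.

Fixpoint all_masks n (p : seq bool -> bool) : bool :=
  if n is n'.+1
  then all_masks n' (fun b => p (true :: b)) && all_masks n' (fun b => p (false :: b))
  else p [::].

Lemma all_masksP n p b : all_masks n p -> size b = n -> p b.
Proof.
elim: n p b => [|n IHn] p [|c b] //= /andP[pt pf] [sb].
by case: c; [apply: IHn pt sb | apply: IHn pf sb].
Qed.

(* Each family of disjoint cliques stands for the partition obtained by adding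
   the remaining vertices as singletons.  The twelve families come from a greedy
   search: for every [S], the restriction of one of them is a minimum clique cover. *)
Definition clique_families : seq (seq (seq nat)) :=
  [:: [:: [:: 0; 4; 8]; [:: 1; 5]; [:: 2; 9]; [:: 6; 10]];
      [:: [:: 0; 9]; [:: 1; 5]; [:: 4; 10]; [:: 6; 8]];
      [:: [:: 0; 5]; [:: 1; 4]; [:: 2; 8]; [:: 6; 10]];
      [:: [:: 0; 5]; [:: 2; 9]; [:: 4; 10]; [:: 6; 8]];
      [:: [:: 0; 9]; [:: 1; 5]; [:: 2; 8]; [:: 6; 10]];
      [:: [:: 1; 4]; [:: 2; 9]; [:: 6; 8]];
      [:: [:: 1; 5]; [:: 2; 8]; [:: 4; 10]];
      [:: [:: 0; 9]; [:: 1; 4]; [:: 6; 10]];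
      [:: [:: 1; 5]; [:: 2; 9]; [:: 4; 10]; [:: 6; 8]];
      [:: [:: 0; 5]; [:: 1; 4]; [:: 2; 9]; [:: 6; 10]];
      [:: [:: 0; 9]; [:: 1; 4]; [:: 6; 8]];
      [:: [:: 0; 5]; [:: 2; 8]; [:: 4; 10]]].

(** A canonical label of the part containing [a]: when no clique of [F] contains [a], both defaults
    apply and [a] labels its own singleton. *)
Definition rep (F : seq (seq nat)) (a : nat) : nat :=
  head a (nth [::] F (find (fun C => a \in C) F)).

(** All eight orientations of the triangle on the receivers. *)
Definition tournaments : seq (seq (nat * nat)) :=
  [seq p :: t | p <- [:: (0, 1); (1, 0)],
                t <- [seq [:: q; r] | q <- [:: (0, 2); (2, 0)],
                                      r <- [:: (1, 2); (2, 1)]]].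

(* An edge [(i, j)] of [t] discards the messages demanded by [i] and known to [j]. *)
Definition kept (t : seq (nat * nat)) (a : nat) : bool :=
  all (fun e => (e.1 == a %/ 4) ==> (a \notin known e.2)) t.

Definition cover_le_kept (b : seq bool) : bool :=
  let s := mask b (iota 0 12) in
  has (fun F => let n := size (undup [seq rep F a | a <- s]) in
                has (fun t => n <= count (kept t) s) tournaments)
      clique_families.

Lemma cover_le_keptP b : size b = 12 -> cover_le_kept b.
Proof. by apply: all_masksP; vm_compute. Qed.

Lemma rep_adj F a b : F \in clique_families -> a < 12 -> b < 12 ->
  a != b -> rep F a = rep F b -> adj a b.
Proof.
move=> FF a12 b12 ab /eqP eqr.
have check : all (fun F => all (fun a => all (fun b =>
    (a != b) ==> (rep F a == rep F b) ==> adj a b) (iota 0 12)) (iota 0 12))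
  clique_families by vm_compute.
have /allP/(_ a) := allP check F FF; rewrite mem_iota => /(_ a12)/allP/(_ b).
by rewrite mem_iota => /(_ b12); rewrite ab eqr.
Qed.

Lemma tournamentP t (i j : 'I_3) : t \in tournaments ->
  i != j -> ((val i, val j) \in t) || ((val j, val i) \in t).
Proof.
move=> tT; rewrite -val_eqE /=.
have check : all (fun t => all (fun i => all (fun j =>
    (i != j) ==> ((i, j) \in t) || ((j, i) \in t)) (iota 0 3)) (iota 0 3))
  tournaments by vm_compute.
have /allP/(_ (val i)) := allP check t tT; rewrite mem_iota => /(_ (ltn_ord i)).
by move=> /allP/(_ (val j)); rewrite mem_iota => /(_ (ltn_ord j)) /implyP.
Qed.

Lemma tournament_irr t i : t \in tournaments -> (i, i) \notin t.
Proof.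
move=> tT; apply/negP => itt.
have check : all (all (fun e : nat * nat => e.1 != e.2)) tournaments by vm_compute.
by have /allP/(_ _ itt) := allP check t tT; rewrite eqxx.
Qed.

Lemma card_fibers (T : finType) (T' : eqType) (f : T -> T') (S : {set T}) :
  #|preim_partition f S| <= size (undup [seq f a | a <- enum S]).
Proof.
set u := undup _.
pose fib v := [set b in S | f b == v].
have sub : preim_partition f S \subset [seq fib v | v <- u].
  apply/subsetP => B /imsetP[a aS ->].
  apply/mapP; exists (f a); first by rewrite mem_undup map_f // mem_enum.
  by apply/setP => b; rewrite !inE eq_sym.
apply: leq_trans (subset_leq_card sub) _.
by apply: leq_trans (card_size _) _; rewrite size_map.
Qed.

Lemma clique_partition_le_kept (S : {set 'I_12}) :
  exists (P : {set {set 'I_12}}) (t : seq (nat * nat)),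
    [/\ clique_partition S P, t \in tournaments &
        #|P| <= #|[set a in S | kept t (val a)]|].
Proof.
(* The membership mask of [S] transfers the computed check to sets. *)
have eqs : mask [seq a \in S | a <- enum 'I_12] (iota 0 12) = [seq val a | a <- enum S].
  by rewrite -val_enum_ord -map_mask -filter_mask enumT.
have := @cover_le_keptP [seq a \in S | a <- enum 'I_12].
rewrite size_map size_enum_ord => /(_ erefl); rewrite /cover_le_kept eqs.
case/hasP => F FF /hasP[t tT le].
exists (preim_partition (fun a : 'I_12 => rep F (val a)) S), t; split=> //.
  rewrite /clique_partition preim_partitionP /=.
  apply/forall_inP => B /imsetP[c cS ->].
  apply/forall_inP => a; rewrite inE => /andP[_ /eqP eqa].
  apply/forall_inP => b; rewrite inE => /andP[_ /eqP eqb].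
  apply/implyP => ab; rewrite Gstar_uE.
  exact: (rep_adj FF (ltn_ord a) (ltn_ord b) ab (etrans (esym eqa) eqb)).
apply: leq_trans (card_fibers _ _) _.
rewrite -map_comp count_map in le; apply: leq_trans le _.
rewrite cardE -size_filter; apply: uniq_leq_size.
  by rewrite filter_uniq // enum_uniq.
by move=> a; rewrite mem_filter !mem_enum in_set andbC => /andP[-> pt].
Qed.

(** * Lower bound on the rates of the sub-problem *)

Lemma W_disjoint i j a : a \in W i -> a \in W j -> i = j.
Proof. by rewrite !in_W => /eqP ai /eqP aj; apply: val_inj; rewrite -ai. Qed.

Lemma card_val_preim (S D : {set 'I_12}) :
  #|[set j : {j : 'I_12 | j \in S} | val j \in D]| = #|D :&: S|.
Proof.
rewrite -(card_imset _ val_inj); apply: eq_card => a; rewrite inE.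
apply/imsetP/andP => [[j]|[aD aS]].
  by rewrite inE => jD ->; split=> //; apply: valP.
by exists (exist _ a aS); rewrite // inE.
Qed.

Lemma rate_ge (A : finType) (S : {set 'I_12}) t (q : rat) :
  1 < #|A| -> t \in tournaments -> achievable_rate_loc1 A S q ->
  ((#|[set a in S | kept t (val a)]|)%:R <= q)%R.
Proof.
move=> A1 tT [m [l [enc [R [dec [m0 decP loc ->]]]]]].
have /card_gt0P[a0 _] : 0 < #|A| by apply: ltnW.
pose J : finType := {j : 'I_12 | j \in S}.
(* Locality says nothing about receivers without demand; emptying their sets gives the bound for all
   receivers and keeps decodability, vacuous there. *)
pose R' i := if W i :&: S == set0 then set0 else R i.
pose E (x : {ffun J -> {ffun 'I_m -> A}}) := enc (fun j => x j).
pose B := [set j : J | val j \in [set a : 'I_12 | kept t (val a)]].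
suff : m * #|B| <= l.
  rewrite card_val_preim ler_pdivlMr ?ltr0n // -natrM ler_nat mulnC.
  suff -> : [set a : 'I_12 | kept t (val a)] :&: S = [set a in S | kept t (val a)] by [].
  by apply/setP => a; rewrite !inE andbC.
rewrite -[l in _ <= l]card_ord.
apply: (@tournament_bound J 'I_l 'I_3 A m a0 A1
  (fun i => [set j : J | val j \in W i]) (fun i => [set j : J | val j \in K i]) R' E
  _ _ _ _ _ (fun i j => (val i, val j) \in t)).
- move=> i; apply/pred0P => j /=; rewrite !inE in_W in_K.
  apply/negP => /andP[/eqP <-]; case: j => [[a a12] /= _].
  by move: a a12; do 12! [case=> [//|]].
- move=> i j ij; apply/pred0P => a /=; rewrite !inE; apply/negP => /andP[ai aj].
  by rewrite (W_disjoint ai aj) eqxx in ij.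
- move=> j; have lt3 : val (val j) %/ 4 < 3 by rewrite ltn_divLR ?ltn_ord.
  by exists (Ordinal lt3); rewrite inE in_W.
- move=> i x y eqR eqK j; rewrite inE => jW; apply/ffunP => s.
  rewrite -(decP (fun j => x j) i j jW s) -(decP (fun j => y j) i j jW s).
  congr (dec i _ _ j jW s).
    apply: functional_extensionality => k; apply: eqR.
    rewrite /R'; case: eqP => [WS0|_]; last exact: valP.
    by have := in_set0 (val j); rewrite -WS0 inE jW (valP j).
  apply: functional_extensionality_dep => j'.
  by apply: functional_extensionality_dep => j'K; rewrite eqK ?inE.
- move=> i; rewrite card_val_preim /R'; case: ifPn => [_|/loc //].
  by rewrite cards0.
- by move=> i; apply/negbTE; apply: tournament_irr.
- by move=> i j; apply: tournamentP.
- move=> a i j; rewrite !inE in_W in_K => /allP fr /eqP ai /fr.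
  by rewrite /= ai eqxx.
Qed.

(** * Codes from clique partitions *)

(** The alphabet has no addition of its own; sums are taken in a cyclic group of the same size. *)
Lemma zmod_bijection (A : finType) : 0 < #|A| ->
  exists n (g : A -> 'I_n.+1), bijective g.
Proof.
move=> A0; exists #|A|.-1, (cast_ord (esym (prednK A0)) \o enum_rank).
apply: bij_comp; last exact: enum_rank_bij.
exact: (Bijective (cast_ordK _) (cast_ordKV _)).
Qed.

(** The receiver demanding a message knows the rest of its clique and can subtract it from the
    sum. *)
Lemma achievable_clique_partition (A : finType) (S : {set 'I_12}) P :
  0 < #|A| -> clique_partition S P -> achievable_rate_loc1 A S (#|P|)%:R%R.
Proof.
move=> A0 /andP[/and3P[/eqP covP trivP _] cliqueP].
have [n [g [h gK hK]]] := zmod_bijection A0.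
pose J : finType := {j : 'I_12 | j \in S}.
pose blk (a : 'I_12) (k : 'I_#|P|) := a \in enum_val k.
have blk_ex (j : J) : exists k, blk (val j) k.
  have jP : pblock P (val j) \in P by rewrite pblock_mem // covP; apply: valP.
  by exists (enum_rank_in jP (pblock P (val j)));
    rewrite /blk enum_rankK_in // mem_pblock covP; apply: valP.
pose idx (j : J) := xchoose (blk_ex j).
have idxP j : blk (val j) (idx j) := xchooseP (blk_ex j).
have idx_adj (i j : J) : i != j -> idx i = idx j -> Gstar (val i) (val j).
  move=> ij eqi; have /forall_inP/(_ _ (idxP i)) := forall_inP cliqueP _ (enum_valP (idx i)).
  move=> /forall_inP/(_ (val j)); rewrite eqi => /(_ (idxP j)).
  by rewrite val_eqE ij => /andP[].
pose total (v : J -> 'I_n.+1) (k : 'I_#|P|) := (\sum_(j | idx j == k) v j)%R.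
pose enc (x : msgs A S 1) k := h (total (fun j => g (x j ord0)) k).
(* One symbol per demanded message at most, which is locality 1. *)
pose R i := [set idx j | j in [set j : J | val j \in W i]].
pose dec i (c : {k | k \in R i} -> A)
    (s : forall j : J, val j \in K i -> 'I_1 -> A) (j : J)
    (_ : val j \in W i) (t : 'I_1) : A :=
  (* Extension by 0 avoids membership proofs under the sum; decoding only evaluates [c'] and [s']
     where the receiver has the data. *)
  let c' k := oapp (fun u => g (c u)) 0%R (insub k) in
  let s' j := oapp (fun u : {j : J | val j \in K i} => g (s (val u) (valP u) t)) 0%R (insub j) in
  h (c' (idx j) - \sum_(j' | (idx j' == idx j) && (j' != j)) s' j')%R.
exists 1, #|P|, enc, R, dec; split=> //.
- move=> x i j jW t; rewrite /dec ord1.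
  have kR : idx j \in R i by rewrite imset_f ?inE.
  rewrite (insubT (fun k => k \in R i) kR) /= /enc hK /total (bigD1 j) //=.
  rewrite [X in (_ - X)%R](eq_bigr (fun j' => g (x j' ord0))) ?addrK ?gK //.
  move=> j' /andP[/eqP eqj j'j].
  suff j'K : val j' \in K i by rewrite (insubT (fun j : J => val j \in K i) j'K).
  have /existsP[i' /andP[jW' j'K]] := idx_adj j j' (contra_neq esym j'j) (esym eqj).
  by rewrite (W_disjoint jW jW').
- by move=> i _; rewrite mul1n -card_val_preim leq_imset_card.
- by rewrite divr1.
Qed.

Theorem theorem6 (A : finType) (hA : (1 < #|A|)%N) (S : {set 'I_12}) :
  is_infimum (achievable_rate_loc1 A S) ((clique_cover_number S)%:R)%R.
Proof.
have A0 := ltnW hA.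
have [P [t [cP tT leP]]] := clique_partition_le_kept S.
(* Minimality comes from coding itself: [P'] gives a code, whose rate is at least the number of kept
   messages. *)
have minP P' : clique_partition S P' -> #|P| <= #|P'|.
  move/(achievable_clique_partition A0)/(rate_ge hA tT); rewrite ler_nat.
  exact: leq_trans.
have -> : clique_cover_number S = #|P|.
  rewrite /clique_cover_number -minEnat; apply/eqP; rewrite eqn_leq -!leEnat.
  rewrite bigmin_le_cond //=; apply/bigmin_geP; split=> [|P' /minP //].
  (* The default 12 of the minimum is harmless, since at most 12 messages are kept. *)
  exact: leq_trans leP (leq_trans (max_card _) (eq_leq (card_ord _))).
split=> [q qA|e e0].
  by apply: le_trans (rate_ge hA tT qA); rewrite ler_nat.
exists (#|P|)%:R%R; split; first exact: achievable_clique_partition.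
by rewrite ltrDl.
Qed.
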